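(* Let $K$ be an infinite field of characteristic different from $2$ and $3$, let $A=Ke\oplus U\oplus V$ be a Bernstein algebra over $K$, and let $N=\ker(\omega)=U\oplus V$. Then the following conditions are equivalent: (i) the algebra $A$ is algebraic; (ii) the ideal $N$ is algebraic; (iii) the operators $L_v:U\to U$ are locally algebraic for all $v\in V$.
   Context: Algebras are not assumed associative, unital or finite-dimensional. A Bernstein algebra over $K$ is a commutative $K$-algebra $A$ with a nonzero algebra homomorphism $\omega:A\to K$ (weight function) satisfying $(x^2)^2=\omega(x)^2x^2$ for all $x$. Here $e$ is a nonzero idempotent of $A$ (necessarily $\omega(e)=1$) and $A=Ke\oplus U\oplus V$ is the Peirce decomposition relative to $e$: $U=\{u\in A: 2eu=u\}$, $V=\{v\in A: ev=0\}$, $\ker\omega=U\oplus V$; one has $UV\subseteq U$, so that $L_v(u)=vu$ defines an operator $L_v:U\to U$ for $v\in V$. An element $a$ is algebraic if the subalgebra generated by $a$ is finite-dimensional; an algebra or ideal is algebraic if all its elements are. A linear operator $T:E\to E$ is locally algebraic if for every $a\in E$ there is a nonzero polynomial $P_a\in K[X]$ with $P_a(T)(a)=0$. *)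

(* Defs.v *)
From HB Require Import structures.
From mathcomp Require Import all_boot all_algebra.
From mathcomp Require Import boolp classical_sets cardinality.

Set Implicit Arguments.
Unset Strict Implicit.
Unset Printing Implicit Defensive.

Import GRing.Theory.

Local Open Scope ring_scope.
Local Open Scope classical_set_scope.

(* MathComp has no structure for nonassociative algebras: a (not necessarily
   associative, unital or finite-dimensional) K-algebra is a K-module A with a
   bilinear product mul : {bilinear A -> A -> A}. *)

Record is_bernstein (K : fieldType) (A : lmodType K)
    (mul : {bilinear A -> A -> A}) (omega : {scalar A}) : Prop := IsBernstein {
  bernstein_mulC : commutative mul;
  weightM : {morph omega : x y / mul x y >-> x * y};
  weight_neq0 : exists x, omega x != 0;
  bernsteinE : forall x,
    mul (mul x x) (mul x x) = omega x ^+ 2 *: mul x x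
}.

Definition is_subspace (K : fieldType) (A : lmodType K) (S : set A) : Prop :=
  S 0 /\ forall (k : K) x y, S x -> S y -> S (k *: x + y).

Definition is_subalgebra (K : fieldType) (A : lmodType K)
    (mul : {bilinear A -> A -> A}) (S : set A) : Prop :=
  is_subspace S /\ forall x y, S x -> S y -> S (mul x y).

Definition gen_subalgebra (K : fieldType) (A : lmodType K)
    (mul : {bilinear A -> A -> A}) (a : A) : set A :=
  smallest (is_subalgebra mul) [set a].

Definition finite_dimensional (K : fieldType) (A : lmodType K)
    (S : set A) : Prop :=
  exists (n : nat) (b : 'I_n -> A), (forall i, S (b i)) /\
    forall x, S x -> exists c : 'I_n -> K, x = \sum_(i < n) c i *: b i.

Definition algebraic_elt (K : fieldType) (A : lmodType K)
    (mul : {bilinear A -> A -> A}) (a : A) : Prop :=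
  finite_dimensional (gen_subalgebra mul a).

Definition algebraic_set (K : fieldType) (A : lmodType K)
    (mul : {bilinear A -> A -> A}) (S : set A) : Prop :=
  forall a, S a -> algebraic_elt mul a.

Definition poly_apply (K : fieldType) (E : lmodType K) (P : {poly K})
    (T : E -> E) (a : E) : E :=
  \sum_(i < size P) P`_i *: iter i T a.

Definition locally_algebraic (K : fieldType) (E : lmodType K)
    (T : {linear E -> E}) : Prop :=
  forall a : E, exists2 P : {poly K}, P != 0 & poly_apply P T a = 0.

Definition is_idempotent (K : fieldType) (A : lmodType K)
    (mul : {bilinear A -> A -> A}) (e : A) : Prop := mul e e = e.

Definition inU (K : fieldType) (A : lmodType K)
    (mul : {bilinear A -> A -> A}) (e : A) : {pred A} :=
  [pred u | 2%:R *: mul e u == u].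

Lemma inU_submod_closed (K : fieldType) (A : lmodType K)
    (mul : {bilinear A -> A -> A}) (e : A) : submod_closed (inU mul e).
Proof.
split=> [|k u v]; rewrite !inE ?linear0r ?scaler0 //.
move=> /eqP hu /eqP hv.
by rewrite linearDr linearZr_LR /= scalerDr scalerA mulrC -scalerA hu hv.
Qed.

HB.instance Definition _ (K : fieldType) (A : lmodType K)
    (mul : {bilinear A -> A -> A}) (e : A) :=
  GRing.isSubmodClosed.Build K A (inU mul e) (inU_submod_closed mul e).

Record peirceU (K : fieldType) (A : lmodType K)
    (mul : {bilinear A -> A -> A}) (e : A) := PeirceU {
  peirceU_val :> A;
  peirceU_valP : peirceU_val \in inU mul e
}.

HB.instance Definition _ (K : fieldType) (A : lmodType K)
    (mul : {bilinear A -> A -> A}) (e : A) :=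
  [isSub for @peirceU_val K A mul e].
HB.instance Definition _ (K : fieldType) (A : lmodType K)
    (mul : {bilinear A -> A -> A}) (e : A) :=
  [Choice of peirceU mul e by <:].
HB.instance Definition _ (K : fieldType) (A : lmodType K)
    (mul : {bilinear A -> A -> A}) (e : A) :=
  [SubChoice_isSubLmodule of peirceU mul e by <:].

Definition peirceV (K : fieldType) (A : lmodType K)
    (mul : {bilinear A -> A -> A}) (e : A) : set A :=
  [set v | mul e v = 0].

Lemma mulrn_eq0_lmod (K : fieldType) (A : lmodType K) (n : nat) (x : A) :
  n%:R != 0 :> K -> x *+ n = 0 -> x = 0.
Proof.
move=> n0 /eqP; rewrite -scaler_nat scaler_eq0 (negPf n0).
by move=> /eqP.
Qed.

Lemma half_sum_diff (K : fieldType) (A : lmodType K) (x y a b : A) :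
  2%:R != 0 :> K -> x + y = a + b -> x - y = a - b -> x = a /\ y = b.
Proof.
move=> n2 hD hB.
have hx : x = a.
  apply/eqP; rewrite -subr_eq0; apply/eqP; apply: (mulrn_eq0_lmod n2).
  have : (x + y) + (x - y) = (a + b) + (a - b) by rewrite hD hB.
  by rewrite addrACA subrr addr0 [RHS]addrACA subrr addr0 mulrnBl !mulr2n
     => ->; rewrite subrr.
by split=> //; move: hD; rewrite hx => /addrI.
Qed.

Lemma mul_sqrD (K : fieldType) (A : lmodType K)
    (mul : {bilinear A -> A -> A}) (x y : A) : commutative mul ->
  mul (x + y) (x + y) = mul x x + mul x y *+ 2 + mul y y.
Proof.
by move=> mC; rewrite linearDl !linearDr (mC y x) mulr2n !addrA.
Qed.

Lemma polarize_idem (K : fieldType) (A : lmodType K)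
    (mul : {bilinear A -> A -> A}) (k s r : A) :
  2%:R != 0 :> K -> commutative mul ->
  k + mul (s + r) (s + r) = s + r -> k + mul (s - r) (s - r) = s - r ->
  (k + mul r r) + mul s s = s /\ mul s r *+ 2 = r.
Proof.
move=> n2 mC.
rewrite -[s - r]/(s + - r) !mul_sqrD // !linearNr linearNl opprK mulNrn.
by rewrite ![mul s s + _ + _]addrC ![k + (_ + (_ + _))]addrA ![k + _ + (_ + _)]addrA;
  exact: (half_sum_diff n2).
Qed.

Section PeirceUV.

Variables (K : fieldType) (A : lmodType K) (mul : {bilinear A -> A -> A}).
Variables (omega : {scalar A}) (e : A).
Hypothesis char2 : 2%N \notin [pchar K].
Hypothesis char3 : 3%N \notin [pchar K].
Hypothesis hB : is_bernstein mul omega.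
Hypothesis he0 : e != 0.
Hypothesis he : is_idempotent mul e.

Lemma weight_idem : omega e = 1.
Proof.
have w2 : omega e * omega e = omega e by rewrite -(weightM hB) he.
have [w0|w0] := eqVneq (omega e) 0; last exact/(mulfI w0)/(etrans w2)/esym/mulr1.
have := bernsteinE hB e; rewrite !he w0 expr0n /= scale0r => e0.
by move: he0; rewrite e0 eqxx.
Qed.

Lemma weightU u : u \in inU mul e -> omega u = 0.
Proof.
rewrite inE => /eqP hu.
have : omega u = 2%:R * omega u.
  by rewrite -{1}hu linearZ /= (weightM hB) weight_idem mul1r.
by rewrite mulr_natl mulr2n => /(congr1 (fun t => t - omega u));
  rewrite subrr addrK.
Qed.

Lemma weightV v : peirceV mul e v -> omega v = 0.
Proof.
by move=> hv; rewrite -[LHS]mul1r -weight_idem -(weightM hB) hv linear0.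
Qed.

Lemma peirce_UV_polarized u v : u \in inU mul e -> peirceV mul e v ->
  mul (e + mul u u + mul v v) (mul u v) *+ 2 = mul u v.
Proof.
move=> hu hv; have mC := bernstein_mulC hB.
have n2 : 2%:R != 0 :> K by move: char2; rewrite !inE.
have key u' v' : u' \in inU mul e -> peirceV mul e v' ->
    mul (e + mul u' u' + mul v' v' + mul u' v' *+ 2 + u')
        (e + mul u' u' + mul v' v' + mul u' v' *+ 2 + u') =
    e + mul u' u' + mul v' v' + mul u' v' *+ 2 + u'.
  move=> hu' hv'.
  have eu' : mul e u' + mul e u' = u'.
    by move: hu'; rewrite inE scaler_nat mulr2n => /eqP.
  have w1 : omega (e + u' + v') = 1.
    by rewrite !linearD /= weight_idem (weightU hu') (weightV hv') !addr0.
  have := bernsteinE hB (e + u' + v'); rewrite w1 expr1n scale1r.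
  suff -> : mul (e + u' + v') (e + u' + v') =
     e + mul u' u' + mul v' v' + mul u' v' *+ 2 + u' by [].
  rewrite !mul_sqrD // he mulr2n eu' linearDl hv' add0r.
  by rewrite [LHS](ACl (1*3*5*4*2)).
have step u' v' : u' \in inU mul e -> peirceV mul e v' ->
    mul u' u' + mul (e + mul u' u' + mul v' v' + mul u' v' *+ 2)
      (e + mul u' u' + mul v' v' + mul u' v' *+ 2) =
    e + mul u' u' + mul v' v' + mul u' v' *+ 2.
  move=> hu' hv'.
  have h1 := key _ _ hu' hv'.
  have hNu : - u' \in inU mul e by rewrite rpredN.
  have hNv : peirceV mul e (- v') by rewrite /peirceV /= linearNr hv' oppr0.
  have := key _ _ hNu hNv; rewrite !linearNl !linearNr !opprK => h2.
  have := @polarize_idem K A mul 0 _ u' n2 mC; rewrite add0r => H.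
  by have [] := H _ (etrans (add0r _) h1) (etrans (add0r _) h2).
have h1 := step _ _ hu hv.
have hNv : peirceV mul e (- v) by rewrite /peirceV /= linearNr hv oppr0.
have h2 := step _ _ hu hNv; rewrite !linearNl !linearNr !opprK mulNrn in h2.
have [_] := polarize_idem n2 mC h1 h2.
rewrite linearMnr mulrnAC => /eqP; rewrite -subr_eq0 -mulrnBl => /eqP.
by move=> /(mulrn_eq0_lmod n2) /eqP; rewrite subr_eq0 => /eqP.
Qed.

Lemma peirce_UV u v :
  u \in inU mul e -> peirceV mul e v -> mul v u \in inU mul e.
Proof.
move=> hu hv; have mC := bernstein_mulC hB; rewrite mC.
have n2 : 2%:R != 0 :> K by move: char2; rewrite !inE.
have n3 : 3%:R != 0 :> K by move: char3; rewrite !inE.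
have inj2 (x y : A) : x *+ 2 = y *+ 2 -> x = y.
  move=> /eqP; rewrite -subr_eq0 -mulrnBl => /eqP /(mulrn_eq0_lmod n2) /eqP.
  by rewrite subr_eq0 => /eqP.
have zero3 (x y : A) : (x + y *+ 4) = x + y -> y = 0.
  by move=> /addrI; rewrite mulrS -[RHS]addr0 => /addrI /(mulrn_eq0_lmod n3).
have h11 := peirce_UV_polarized hu hv.
have h21 : mul (e + mul u u *+ 4 + mul v v) (mul u v) *+ 2 = mul u v.
  have hu2 : u *+ 2 \in inU mul e by rewrite rpredMn.
  apply: inj2; have := peirce_UV_polarized hu2 hv.
  by rewrite !linearMnl !linearMnr -!mulrnA.
have h12 : mul (e + mul u u + mul v v *+ 4) (mul u v) *+ 2 = mul u v.
  have hv2 : peirceV mul e (v *+ 2) by rewrite /peirceV /= linearMnr hv mul0rn.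
  apply: inj2; have := peirce_UV_polarized hu hv2.
  by rewrite !linearMnl !linearMnr -!mulrnA.
have uu0 : mul (mul u u) (mul u v) = 0.
  apply: (zero3 (mul (e + mul v v) (mul u v))); apply: inj2.
  by rewrite -linearMnl -!linearDl addrAC h21 addrAC h11.
have vv0 : mul (mul v v) (mul u v) = 0.
  apply: (zero3 (mul (e + mul u u) (mul u v))); apply: inj2.
  by rewrite -linearMnl -!linearDl h12 h11.
by move: h11; rewrite !linearDl uu0 vv0 !addr0 inE scaler_nat => ->.
Qed.

Definition peirceL (v : A) (hv : peirceV mul e v) (u : peirceU mul e) :
    peirceU mul e :=
  PeirceU (peirce_UV (peirceU_valP u) hv).

Lemma peirceL_is_linear (v : A) (hv : peirceV mul e v) : linear (peirceL hv).
Proof. by move=> k u1 u2; apply: val_inj => /=; rewrite linearP. Qed.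

HB.instance Definition _ (v : A) (hv : peirceV mul e v) :=
  GRing.isLinear.Build K (peirceU mul e) (peirceU mul e) *:%R (peirceL hv)
    (peirceL_is_linear hv).

End PeirceUV.

(* Main.v *)
(* Linearizing the defining identity gives, for u_i in U and v, v' in V:
     U U <= V, V V <= U, u (v v') = 0, (v u1) u2 = - u1 (v u2),
     (u1 u2) u3 + cyclic = 0 and (u1 u2) (v u3) + cyclic = 0.
   Fix v and put L = L_v. These identities force (L^i u L^j u) L^k u = 0.
   Moreover the annihilator of U in U contains V V and is stable under L.
   If N is algebraic, take a = v + u: modulo V and the annihilator, the sequence
   L_a^n(a^2) is 2 L^(n+1) u, so a linear relation in it gives a nonzero P with
   P(L) u in the annihilator, where L is locally algebraic because
   L_(v + w)^n((v + w)^2) = 2 L^(n+1) w + L^n(v^2) for w in the annihilator.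
   Conversely, if the L_v are locally algebraic, then k e + u + v lies in an
   explicit finite-dimensional subalgebra built from the orbits of L. *)

Require Import Defs.
From HB Require Import structures.
From mathcomp Require Import all_boot all_algebra.
From mathcomp Require Import boolp classical_sets cardinality.

Set Implicit Arguments.
Unset Strict Implicit.
Unset Printing Implicit Defensive.

Import GRing.Theory.

Local Open Scope ring_scope.
Local Open Scope classical_set_scope.

(** * Linear identities in an abelian group, decided by computation *)

Section ZmodNormalization.

Inductive zexp : Type :=
  | ZVar of nat | ZZero | ZAdd of zexp & zexp | ZOpp of zexp
  | ZMuln of zexp & nat.

Fixpoint zcoef (t : zexp) (i : nat) : int :=
  match t with
  | ZVar j => (i == j)%:Z
  | ZZero => 0
  | ZAdd a b => zcoef a i + zcoef b i
  | ZOpp a => - zcoef a i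
  | ZMuln a n => zcoef a i *+ n
  end.

Variable V : zmodType.

Fixpoint zeval (s : seq V) (t : zexp) : V :=
  match t with
  | ZVar j => s`_j
  | ZZero => 0
  | ZAdd a b => zeval s a + zeval s b
  | ZOpp a => - zeval s a
  | ZMuln a n => zeval s a *+ n
  end.

(** The integer coefficients of the atoms form a normal form. An index beyond [size s] evaluates to
    the default 0, so it contributes to neither side. *)
Lemma zevalE (s : seq V) (t : zexp) :
  zeval s t = \sum_(i < size s) s`_i *~ zcoef t i.
Proof.
elim: t => [j||a IHa b IHb|a IHa|a IHa n] /=; rewrite ?IHa ?IHb.
- have [jlt|jge] := ltnP j (size s).
    rewrite (bigD1 (Ordinal jlt)) //= eqxx mulr1z big1 ?addr0 // => i ij.
    by rewrite (_ : (i == j :> nat) = false) ?mulr0z //; apply/negbTE.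
  rewrite nth_default // big1 // => i _.
  by rewrite (ltn_eqF (leq_trans (ltn_ord i) jge)) mulr0z.
- by rewrite big1 // => i _; rewrite mulr0z.
- by rewrite -big_split; apply: eq_bigr => i _; rewrite mulrzDr.
- by rewrite -sumrN; apply: eq_bigr => i _; rewrite mulrNz.
- by rewrite -sumrMnl; apply: eq_bigr => i _; rewrite -mulr_natr mulrzA natz.
Qed.

(** The hypothesis reduces to [true] whenever all multiplicities are numerals; this is how [zmod]
    can pass [isT]. *)
Lemma zeval_eq (s : seq V) (a b : zexp) :
  all (fun i => zcoef a i == zcoef b i) (iota 0 (size s)) ->
  zeval s a = zeval s b.
Proof.
move=> /allP ab; rewrite !zevalE; apply: eq_bigr => i _.
by rewrite (eqP (ab i _)) // mem_iota /=.
Qed.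

End ZmodNormalization.

(** Derives an identity from a known one [l = r]. The remaining equation holds formally, and [zmod]
    closes it once commutativity has made equal products syntactically equal. *)
Lemma eq_from_sub (V : zmodType) (l r x y : V) :
  l = r -> x - y = l - r -> x = y.
Proof. by move=> ->; rewrite subrr => /subr0_eq. Qed.

Ltac zindex x s :=
  lazymatch s with
  | x :: _ => constr:(0%N)
  | _ :: ?s' => let n := zindex x s' in constr:(S n)
  end.
Ltac zmember x s :=
  lazymatch s with
  | nil => constr:(false)
  | x :: _ => constr:(true)
  | _ :: ?s' => zmember x s'
  end.
Ltac zatoms t s :=
  lazymatch t with
  | @GRing.add _ ?a ?b => let s1 := zatoms a s in zatoms b s1
  | @GRing.opp _ ?a => zatoms a s
  | @GRing.natmul _ ?a ?n => zatoms a s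
  | @GRing.zero _ => s
  | _ => lazymatch zmember t s with
         | true => s
         | false => constr:(t :: s)
         end
  end.
Ltac zreify t s :=
  lazymatch t with
  | @GRing.add _ ?a ?b =>
      let a' := zreify a s in let b' := zreify b s in constr:(ZAdd a' b')
  | @GRing.opp _ ?a => let a' := zreify a s in constr:(ZOpp a')
  | @GRing.natmul _ ?a ?n => let a' := zreify a s in constr:(ZMuln a' n)
  | @GRing.zero _ => constr:(ZZero)
  | _ => let i := zindex t s in constr:(ZVar i)
  end.
Ltac zmod :=
  lazymatch goal with
  | |- @eq ?T ?a ?b =>
    let s0 := zatoms a (@nil T) in
    let s := zatoms b s0 in
    let a' := zreify a s in
    let b' := zreify b s in
    exact (@zeval_eq _ s a' b' isT)
  end.

(** * Polynomials in a linear operator *)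

Section PolyApply.

Variables (K : fieldType) (E : lmodType K) (T : {linear E -> E}).

Lemma iter_linear (n : nat) : linear (iter n T).
Proof. by elim: n => [|n IH] k x y //=; rewrite IH linearP. Qed.

Lemma poly_apply_widen (n : nat) (P : {poly K}) (a : E) : (size P <= n)%N ->
  poly_apply P T a = \sum_(i < n) P`_i *: iter i T a.
Proof.
move=> Pn; rewrite /poly_apply.
rewrite (big_ord_widen n (fun i => P`_i *: iter i T a)) // big_mkcond /=.
by apply: eq_bigr => i _; case: ltnP => // /(nth_default 0) ->; rewrite scale0r.
Qed.

Lemma poly_applyD (P Q : {poly K}) (a : E) :
  poly_apply (P + Q) T a = poly_apply P T a + poly_apply Q T a.
Proof.
rewrite !(@poly_apply_widen (maxn (size P) (size Q))) ?leq_maxl ?leq_maxr //.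
  by rewrite -big_split; apply: eq_bigr => i _; rewrite coefD scalerDl.
exact: size_polyD.
Qed.

Lemma poly_applyC (c : K) (a : E) : poly_apply c%:P T a = c *: a.
Proof.
by rewrite (poly_apply_widen a (size_polyC_leq1 c)) big_ord1 coefC eqxx.
Qed.

Lemma poly_applyZ (c : K) (P : {poly K}) (a : E) :
  poly_apply (c *: P) T a = c *: poly_apply P T a.
Proof.
rewrite (poly_apply_widen a (size_scale_leq c P)) scaler_sumr.
by apply: eq_bigr => i _; rewrite coefZ scalerA.
Qed.

Lemma poly_applyMX (P : {poly K}) (a : E) :
  poly_apply (P * 'X) T a = poly_apply P T (T a).
Proof.
have sPX : (size (P * 'X)%R <= (size P).+1)%N.
  by apply: leq_trans (size_polyMleq _ _) _; rewrite size_polyX addn2.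
rewrite (poly_apply_widen a sPX) big_ord_recl coefMX eqxx scale0r add0r.
by apply: eq_bigr => i _; rewrite coefMX /= -iterSr.
Qed.

Lemma poly_apply_linear (P : {poly K}) : linear (poly_apply P T).
Proof.
move=> k x y; rewrite /poly_apply scaler_sumr -big_split.
apply: eq_bigr => i _.
by rewrite /= iter_linear scalerDr !scalerA mulrC.
Qed.

Lemma poly_apply0 (P : {poly K}) : poly_apply P T 0 = 0.
Proof.
have := poly_apply_linear P (-1) 0 0.
by rewrite scaler0 add0r scaleN1r addNr.
Qed.

Lemma poly_applyM (P Q : {poly K}) (a : E) :
  poly_apply (P * Q) T a = poly_apply P T (poly_apply Q T a).
Proof.
elim/poly_ind: Q a => [|Q c IH] a.
  by rewrite mulr0 -polyC0 !poly_applyC scale0r poly_apply0.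
rewrite mulrDr mulrA !poly_applyD !poly_applyMX IH addrC mulrC mul_polyC.
by rewrite poly_applyZ poly_applyC [in RHS]addrC poly_apply_linear.
Qed.

(** The condition of [locally_algebraic] at a single vector. It makes sense for [mul v] on all of
    [A], without restriction to U. *)
Definition algebraic_at (a : E) : Prop :=
  exists2 P : {poly K}, P != 0 & poly_apply P T a = 0.

Lemma algebraic_at_poly (P : {poly K}) (a : E) :
  P != 0 -> algebraic_at (poly_apply P T a) -> algebraic_at a.
Proof.
move=> P0 [Q Q0 Qa]; exists (Q * P); first exact: mulf_neq0.
by rewrite poly_applyM.
Qed.

Lemma algebraic_at_image (a : E) : algebraic_at (T a) -> algebraic_at a.
Proof.
move=> Ta; apply: (@algebraic_at_poly 'X); first by rewrite polyX_eq0.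
by rewrite -['X]mul1r poly_applyMX poly_applyC scale1r.
Qed.

(** The product of two annihilating polynomials is nonzero and, by commutativity, kills both
    vectors. *)
Lemma algebraic_at_subspace : is_subspace [set a | algebraic_at a].
Proof.
split; first by exists 1; rewrite ?oner_neq0 // poly_apply0.
move=> k x y [P P0 Px] [Q Q0 Qy]; exists (P * Q); first exact: mulf_neq0.
by rewrite poly_apply_linear {1}[P * Q]mulrC !poly_applyM Px Qy !poly_apply0
  scaler0 addr0.
Qed.

End PolyApply.

(** * Spans, finite dimension and generated subalgebras *)

Section FiniteDimension.

Variables (K : fieldType) (A : lmodType K).

(** Coefficients are functions on [nat], of which only the first [size s] values matter, so their
    type does not depend on the list. *)
Definition lspan (s : seq A) : set A :=
  [set x | exists c : nat -> K, x = \sum_(i < size s) c i *: s`_i].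

Lemma subspaceD (S : set A) x y : is_subspace S -> S x -> S y -> S (x + y).
Proof. by move=> [_ H] Sx Sy; rewrite -[x]scale1r; apply: H. Qed.

Lemma subspaceZ (S : set A) k x : is_subspace S -> S x -> S (k *: x).
Proof. by move=> [S0 H] Sx; rewrite -[_ *: _]addr0; apply: H. Qed.

Lemma subspace_sum (S : set A) n (F : 'I_n -> A) :
  is_subspace S -> (forall i, S (F i)) -> S (\sum_i F i).
Proof.
move=> hS SF; elim/big_ind: _ => //; first by case: hS.
by move=> x y; apply: subspaceD.
Qed.

Lemma lspan_subspace s : is_subspace (lspan s).
Proof.
split; first by exists (fun=> 0); rewrite big1 // => i _; rewrite scale0r.
move=> k _ _ [c ->] [d ->]; exists (fun i => k * c i + d i).
rewrite scaler_sumr -big_split; apply: eq_bigr => i _.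
by rewrite /= scalerDl scalerA.
Qed.

Lemma lspan_mem s x : x \in s -> lspan s x.
Proof.
move=> xs; exists (fun i => (i == index x s)%:R).
have xlt : (index x s < size s)%N by rewrite index_mem.
rewrite (bigD1 (Ordinal xlt)) //= eqxx scale1r nth_index // big1 ?addr0 // => i.
move=> ix; rewrite (_ : (i == index x s :> nat) = false) ?scale0r //.
exact/negbTE.
Qed.

Lemma lspan_min s (S : set A) :
  is_subspace S -> (forall x, x \in s -> S x) -> lspan s `<=` S.
Proof.
move=> hS sS _ [c ->]; apply: subspace_sum => // i; apply: subspaceZ => //.
exact/sS/mem_nth.
Qed.

Lemma sub_lspan (s t : seq A) : {subset s <= t} -> lspan s `<=` lspan t.
Proof.
by move=> st; apply: lspan_min (lspan_subspace t) _ => x /st; apply: lspan_mem.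
Qed.

(** The leading coefficient of an annihilating polynomial is invertible, so each iterate from its
    degree on is a combination of earlier ones. *)
Lemma krylov_span (T : {linear A -> A}) a : algebraic_at T a ->
  exists d, forall n, lspan (mkseq (fun i => iter i T a) d) (iter n T a).
Proof.
move=> [P P0 Pa]; exists (size P).-1 => n.
set s := mkseq _ _; have hs := lspan_subspace s.
elim/ltn_ind: n => n IH; have [nd|dn] := ltnP n (size P).-1.
  by apply: lspan_mem; apply/mapP; exists n; rewrite ?mem_iota.
have sP : size P = (size P).-1.+1 by rewrite prednK // size_poly_gt0.
have l0 : P`_(size P).-1 != 0 by rewrite -/(lead_coef P) lead_coef_eq0.
have lin m : linear (iter m T) := iter_linear T m.
(* With d the degree of [P], applying T^(n - d) to P(T) a = 0 gives a relation whose top term is the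
   n-th iterate. *)
have H : \sum_(i < size P) P`_i *: iter (i + (n - (size P).-1)) T a = 0.
  have iter0 m : iter m T 0 = 0 by elim: m => //= m ->; rewrite linear0.
  have iterD' m x y : iter m T (x + y) = iter m T x + iter m T y.
    by have := lin m 1 x y; rewrite !scale1r.
  rewrite -[RHS](iter0 (n - (size P).-1)%N) -[in RHS]Pa.
  rewrite (big_morph _ (iterD' _) (iter0 _)); apply: eq_bigr => i _.
  by rewrite addnC iterD -[LHS]addr0 -(iter0 (n - (size P).-1)%N) -lin addr0.
move: H; rewrite sP big_ord_recr /= subnKC // => /eqP.
rewrite addrC addr_eq0 => /eqP /(congr1 (fun x => (P`_(size P).-1)^-1 *: x)).
rewrite scalerA mulVf // scale1r => ->; rewrite -scaleN1r.
do 2![apply: subspaceZ => //]; apply: subspace_sum => // i.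
apply: subspaceZ => //.
by apply: IH; rewrite -[X in (_ < X)%N](subnKC dn) ltn_add2r.
Qed.

(** The linear relation is recorded as a polynomial, so that for a sequence of iterates of T it
    reads P(T) a = 0. *)
Lemma fd_dependent (S : set A) (x : nat -> A) :
  finite_dimensional S -> (forall n, S (x n)) ->
  exists2 P : {poly K}, P != 0 & \sum_(i < size P) P`_i *: x i = 0.
Proof.
move=> [n [b [_ bS]]] Sx.
have /choice[c xE] j : exists c : 'I_n -> K, x j = \sum_(i < n) c i *: b i.
  exact: bS.
pose M := \matrix_(j < n.+1, i < n) c j i.
(* [M] has one more row than columns, so its rows are dependent. *)
have : kermx M != 0.
  by rewrite -mxrank_eq0 mxrank_ker -lt0n subn_gt0 ltnS rank_leq_col.
case/rowV0Pn => r /sub_kermxP rM r0.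
pose P := \poly_(j < n.+1) r 0 (inord j).
exists P.
  apply: contraNneq r0 => P0; apply/eqP/rowP => j.
  by have := coef_poly n.+1 (fun j => r 0 (inord j)) j;
    rewrite -/P P0 coef0 ltn_ord inord_val mxE.
have -> : \sum_(i < size P) P`_i *: x i = \sum_(i < n.+1) P`_i *: x i.
  rewrite (big_ord_widen n.+1 (fun i => P`_i *: x i)) ?size_poly // big_mkcond.
  apply: eq_bigr => i _ /=.
  by case: ltnP => // /(nth_default 0) ->; rewrite scale0r.
under eq_bigr => j _ do rewrite coef_poly ltn_ord inord_val xE scaler_sumr.
rewrite exchange_big big1 // => i _ /=.
under eq_bigr => j _ do rewrite scalerA.
rewrite -scaler_suml; have /rowP/(_ i) := rM; rewrite !mxE => rMi.
have -> : \sum_(j < n.+1) r 0 j * c j i = 0.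
  by rewrite -[RHS]rMi; apply: eq_bigr => j _; rewrite mxE.
exact: scale0r.
Qed.

(** [finite_dimensional] wants a spanning family inside [S], while [s] may lie outside. Among the
    coefficient matrices whose rows give elements of [S], one of maximal rank provides the
    family. *)
Lemma subspace_fd (S : set A) (s : seq A) :
  is_subspace S -> S `<=` lspan s -> finite_dimensional S.
Proof.
move=> hS Ss; pose m := size s.
pose comb (c : 'rV[K]_m) : A := \sum_(i < m) c 0 i *: s`_i.
have combP k c d : comb (k *: c + d) = k *: comb c + comb d.
  rewrite /comb scaler_sumr -big_split; apply: eq_bigr => i _.
  by rewrite /= !mxE scalerDl scalerA.
pose good r := exists k (M : 'M[K]_(k, m)),
  (forall i, S (comb (row i M))) /\ \rank M = r.
have ex : exists r, `[< good r >].
  by exists 0%N; apply/asboolP; exists 0%N, 0; split; [case | rewrite mxrank0].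
have ub r : `[< good r >] -> (r <= m)%N.
  by move=> /asboolP[k [M [_ <-]]]; apply: rank_leq_col.
case: (ex_maxnP ex ub) => r /asboolP[k [M [SM rM]]] rmax.
exists k, (fun i => comb (row i M)); split=> // x Sx.
have [c xE] := Ss x Sx; pose z : 'rV[K]_m := \row_i c i.
have zE : comb z = x by rewrite xE; apply: eq_bigr => i _; rewrite mxE.
(* Otherwise stacking [z] under [M] would raise the maximal rank. *)
have /submxP[d zd] : (z <= M)%MS.
  have : (\rank (col_mx M z) <= r)%N.
    apply: rmax; apply/asboolP; exists (k + 1)%N, (col_mx M z); split=> // i.
    by case: (split_ordP i) => j ->; rewrite ?rowKu ?rowKd ?row_id // zE.
  rewrite -rM -addsmxE => rk.
  have : (M == M + z)%MS.
    by rewrite -(geq_leqif (mxrank_leqif_eq (addsmxSl M z))).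
  by move=> /andP[_]; apply: submx_trans; apply: addsmxSr.
exists (fun i => d 0 i); rewrite -zE zd mulmx_sum_row.
have comb0 : comb 0 = 0.
  by have := combP (-1) 0 0; rewrite !scaleN1r !addNr.
have combD x1 x2 : comb (x1 + x2) = comb x1 + comb x2.
  by have := combP 1 x1 x2; rewrite !scale1r.
rewrite (big_morph comb combD comb0); apply: eq_bigr => i _.
by have := combP (d 0 i) (row i M) 0; rewrite !addr0 comb0 addr0.
Qed.

Variable mul : {bilinear A -> A -> A}.

Lemma gen_subalgebraP a : is_subalgebra mul (gen_subalgebra mul a).
Proof.
split; first split.
- by move=> S [[[S0 _] _] _].
- move=> k x y Hx Hy S hS; have [[[_ SP] _] _] := hS.
  by apply: SP; [apply: Hx | apply: Hy].
- move=> x y Hx Hy S hS; have [[_ SM] _] := hS.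
  by apply: SM; [apply: Hx | apply: Hy].
Qed.

Lemma gen_subalgebra_mem a : gen_subalgebra mul a a.
Proof. by move=> S [_ aS]; apply: aS. Qed.

(** By bilinearity [lspan s] is a subalgebra, so it contains the one generated by [a]. *)
Lemma algebraic_elt_span (s : seq A) a :
  {in s &, forall x y, lspan s (mul x y)} -> lspan s a -> algebraic_elt mul a.
Proof.
move=> sM sa; have [hG GM] := gen_subalgebraP a.
apply: (subspace_fd (s := s) hG) => x; apply; split; last by move=> _ ->.
have hs := lspan_subspace s; split=> // y z sy.
apply: (lspan_min (S := [set z | lspan s (mul y z)])) => [|{}z zs /=].
  split=> [|k z1 z2 h1 h2] /=; first by rewrite linear0r; case: hs.
  by rewrite linearDr linearZr_LR /=; case: hs => _; apply.
move: y sy; apply: (lspan_min (S := [set y | lspan s (mul y z)])) => [|y ys /=].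
  split=> [|k z1 z2 h1 h2] /=; first by rewrite linear0l; case: hs.
  by rewrite linearDl linearZl_LR /=; case: hs => _; apply.
exact: sM.
Qed.

End FiniteDimension.

(** * Polarizations of the Bernstein identity on the kernel of the weight *)

Section BernsteinIdentities.

Variables (K : fieldType) (A : lmodType K) (mul : {bilinear A -> A -> A}).
Variables (omega : {scalar A}) (e : A).
Hypothesis char2 : 2%N \notin [pchar K].
Hypothesis char3 : 3%N \notin [pchar K].
Hypothesis hB : is_bernstein mul omega.
Hypothesis he0 : e != 0.
Hypothesis he : is_idempotent mul e.

Local Notation "x ** y" := (mul x y) (at level 40, left associativity).
Local Notation N := [set x | omega x = 0].
Local Notation U := (inU mul e).
Local Notation V := (peirceV mul e).

Let mC : commutative mul := bernstein_mulC hB.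

Let mulDl x y z : (x + y) ** z = x ** z + y ** z. Proof. exact: linearDl. Qed.
Let mulDr x y z : x ** (y + z) = x ** y + x ** z. Proof. exact: linearDr. Qed.
Let mulNl x y : (- x) ** y = - (x ** y). Proof. exact: linearNl. Qed.
Let mulNr x y : x ** (- y) = - (x ** y). Proof. exact: linearNr. Qed.
Let mulMnl x y n : (x *+ n) ** y = (x ** y) *+ n. Proof. exact: linearMnl. Qed.
Let mulMnr x y n : x ** (y *+ n) = (x ** y) *+ n. Proof. exact: linearMnr. Qed.
Let mul0l x : 0 ** x = 0. Proof. exact: linear0l. Qed.
Let mul0r x : x ** 0 = 0. Proof. exact: linear0r. Qed.
(* The [mulMn] rules come first because [x *+ 2] unifies with [x + x]. *)
Let mulE := (mulMnl, mulMnr, mulDl, mulDr, mulNl, mulNr).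

(** Applied backwards, this lemma and the next multiply a goal by 2 or 3, which replaces division
    after polarization. *)
Lemma mulr2n_inj : injective (fun x : A => x *+ 2).
Proof.
move=> x y /eqP; rewrite -subr_eq0 -mulrnBl => /eqP /mulrn_eq0_lmod.
by move: char2; rewrite !inE /= => n2 /(_ n2) /eqP; rewrite subr_eq0 => /eqP.
Qed.

Lemma mulr3n_inj : injective (fun x : A => x *+ 3).
Proof.
move=> x y /eqP; rewrite -subr_eq0 -mulrnBl => /eqP /mulrn_eq0_lmod.
by move: char3; rewrite !inE /= => n3 /(_ n3) /eqP; rewrite subr_eq0 => /eqP.
Qed.

Lemma ker_addsub x y : N x -> N y -> N (x + y) /\ N (x - y).
Proof. by move=> /= Nx Ny; rewrite linearB linearD /= Nx Ny addr0 subr0. Qed.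

Lemma quartic_N x : N x -> (x ** x) ** (x ** x) = 0.
Proof. by move=> Nx; rewrite (bernsteinE hB) Nx expr0n scale0r. Qed.

(** Adding [quartic_N] at [x + y] and [x - y] leaves 4 times the part of degree 2 in each variable.
    [quartic_N3] and [quartic_N4] then polarize in [y] and in [x]. *)
Lemma quartic_N2 x y : N x -> N y ->
  (x ** x) ** (y ** y) + ((x ** y) ** (x ** y)) *+ 2 = 0.
Proof.
move=> Nx Ny; have [ND NB] := ker_addsub Nx Ny.
apply: mulr2n_inj; apply: mulr2n_inj; rewrite /= !mul0rn.
have H : ((x + y) ** (x + y)) ** ((x + y) ** (x + y)) +
   ((x - y) ** (x - y)) ** ((x - y) ** (x - y)) =
   ((x ** x) ** (x ** x)) *+ 2 + ((y ** y) ** (y ** y)) *+ 2.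
  by rewrite !quartic_N // !mul0rn.
apply: (eq_from_sub H); rewrite !mulE (mC y x) (mC (y ** y) (x ** x)).
rewrite (mC (x ** y) (x ** x)) (mC (x ** y) (y ** y)).
by zmod.
Qed.

Lemma quartic_N3 x y w : N x -> N y -> N w ->
  (x ** x) ** (y ** w) + ((x ** y) ** (x ** w)) *+ 2 = 0.
Proof.
move=> Nx Ny Nw; have [ND NB] := ker_addsub Ny Nw.
apply: mulr2n_inj; rewrite /= mul0rn.
have H := quartic_N2 Nx ND.
have H1 := quartic_N2 Nx Ny; have H2 := quartic_N2 Nx Nw.
apply: (eq_from_sub
  (etrans H (esym (etrans (congr2 +%R H1 H2) (addr0 0))))).
rewrite !mulE (mC w y) (mC (x ** w) (x ** y)).
by zmod.
Qed.

Lemma quartic_N4 x y z w : N x -> N y -> N z -> N w ->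
  (x ** z) ** (y ** w) + (x ** y) ** (z ** w) + (z ** y) ** (x ** w) = 0.
Proof.
move=> Nx Ny Nz Nw; have [ND NB] := ker_addsub Nx Nz.
apply: mulr2n_inj; rewrite /= mul0rn.
have H := quartic_N3 ND Ny Nw.
have H1 := quartic_N3 Nx Ny Nw; have H2 := quartic_N3 Nz Ny Nw.
apply: (eq_from_sub
  (etrans H (esym (etrans (congr2 +%R H1 H2) (addr0 0))))).
rewrite !mulE (mC z x).
by zmod.
Qed.

Let NN x : N x -> N (- x).
Proof. by move=> /= Nx; rewrite linearN /= Nx oppr0. Qed.

(* The defining identity at e + x. *)
Lemma quartic_eN x : N x ->
  (e ** (e ** x)) *+ 4 + (e ** (x ** x)) *+ 2 + ((e ** x) ** (e ** x)) *+ 4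
   + ((e ** x) ** (x ** x)) *+ 4 = (e ** x) *+ 2 + x ** x.
Proof.
move=> Nx; have := bernsteinE hB (e + x).
have -> : omega (e + x) = 1.
  by rewrite linearD /= (weight_idem hB he0 he) Nx addr0.
rewrite expr1n scale1r => H; have Q := quartic_N Nx.
apply: (eq_from_sub
  (etrans H (esym (etrans (congr2 +%R Q (erefl _)) (add0r _))))).
rewrite !mulE ![e ** e]he (mC x e) (mC (e ** x) e) (mC (x ** x) e).
rewrite (mC (x ** x) (e ** x)).
by zmod.
Qed.

(** The part of [quartic_eN] even in [x]; [idem_mul] polarizes it, and [idem_odd] is the odd
    part. *)
Lemma idem_sqr x : N x ->
  (e ** (x ** x)) *+ 2 + ((e ** x) ** (e ** x)) *+ 4 = x ** x.
Proof.
move=> Nx; apply: mulr2n_inj => /=.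
have H := congr2 +%R (quartic_eN Nx) (quartic_eN (NN Nx)).
by apply: (eq_from_sub H); rewrite !mulE; zmod.
Qed.

Lemma idem_mul x y : N x -> N y ->
  (e ** (x ** y)) *+ 2 + ((e ** x) ** (e ** y)) *+ 4 = x ** y.
Proof.
move=> Nx Ny; have [ND NB] := ker_addsub Nx Ny.
apply: mulr2n_inj => /=.
have H := congr2 (fun a b => a - b) (idem_sqr ND)
  (congr2 +%R (idem_sqr Nx) (idem_sqr Ny)).
by apply: (eq_from_sub H); rewrite !mulE (mC y x) (mC (e ** y)); zmod.
Qed.

Lemma idem_odd x : N x ->
  (e ** (e ** x)) *+ 2 + ((e ** x) ** (x ** x)) *+ 2 = e ** x.
Proof.
move=> Nx; apply: mulr2n_inj; apply: mulr2n_inj => /=.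
have H := congr2 (fun a b => a - b) (quartic_eN Nx) (quartic_eN (NN Nx)).
by apply: (eq_from_sub H); rewrite !mulE; zmod.
Qed.

Lemma idem_idem x : N x -> (e ** (e ** x)) *+ 2 = e ** x.
Proof.
move=> Nx; apply: mulr2n_inj; apply: mulr3n_inj => /=.
have [N2 _] := ker_addsub Nx Nx; rewrite -mulr2n in N2.
(* [idem_odd] mixes degrees 1 and 3 in [x]. Subtracting its value at 2x from 8 times its value at
   [x] cancels degree 3 and leaves 8 - 2 = 6 times degree 1. *)
have H := congr2 (fun a b => a *+ 8 - b) (idem_odd Nx) (idem_odd N2).
by apply: (eq_from_sub H); rewrite !mulE; zmod.
Qed.

(** The degree 3 part of [idem_odd], once [idem_idem] has been removed; [cubic2] and [cubic3] are
    its polarizations. *)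
Lemma cubic1 x : N x -> (e ** x) ** (x ** x) = 0.
Proof.
move=> Nx; apply: mulr2n_inj; rewrite /= mul0rn.
have H := congr2 (fun a b => a - b) (idem_odd Nx) (idem_idem Nx).
by apply: (eq_from_sub H); zmod.
Qed.

Lemma cubic2 x y : N x -> N y ->
  (e ** y) ** (x ** x) + ((e ** x) ** (x ** y)) *+ 2 = 0.
Proof.
move=> Nx Ny; have [ND NB] := ker_addsub Nx Ny.
apply: mulr2n_inj; rewrite /= mul0rn.
have H : (e ** (x + y)) ** ((x + y) ** (x + y)) -
   (e ** (x - y)) ** ((x - y) ** (x - y)) =  ((e ** y) ** (y ** y)) *+ 2.
  by rewrite !cubic1 // mul0rn subr0.
by apply: (eq_from_sub H); rewrite !mulE (mC y x); zmod.
Qed.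

Lemma cubic3 x y z : N x -> N y -> N z ->
  (e ** x) ** (y ** z) + (e ** y) ** (z ** x) + (e ** z) ** (x ** y) = 0.
Proof.
move=> Nx Ny Nz; have [ND NB] := ker_addsub Ny Nz.
apply: mulr2n_inj; rewrite /= mul0rn.
have H : (e ** x) ** ((y + z) ** (y + z)) +
     ((e ** (y + z)) ** ((y + z) ** x)) *+ 2
   = ((e ** x) ** (y ** y) + ((e ** y) ** (y ** x)) *+ 2) +
    ((e ** x) ** (z ** z) + ((e ** z) ** (z ** x)) *+ 2).
  by rewrite !cubic2 // addr0.
by apply: (eq_from_sub H); rewrite !mulE (mC z y) (mC y x); zmod.
Qed.

(** * Multiplication rules for the Peirce components *)

Lemma inU_double u : u \in U -> (e ** u) *+ 2 = u.
Proof. by rewrite inE scaler_nat => /eqP. Qed.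

Lemma inUP u : (e ** u) *+ 2 = u -> u \in U.
Proof. by move=> eu; rewrite inE scaler_nat eu. Qed.

Let NU u : u \in U -> N u := weightU hB he0 he (u := u).
Let NV v : V v -> N v := weightV hB he0 he (v := v).

(** By [idem_idem], twice the multiplication by [e] is a projection of the kernel of the weight,
    with image U and kernel V. *)
Lemma peirce_decomp x : N x -> exists u v, [/\ u \in U, V v & x = u + v].
Proof.
move=> Nx; exists ((e ** x) *+ 2), (x - (e ** x) *+ 2).
split; last by rewrite addrC subrK.
- by apply: inUP; rewrite mulMnr idem_idem.
- rewrite /peirceV /= !mulE. by rewrite idem_idem // subrr.
Qed.

Lemma peirceUV0 x : x \in U -> V x -> x = 0.
Proof. by move=> /inU_double Ux Vx; rewrite -Ux Vx mul0rn. Qed.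

(** On U the term [((e ** x) ** (e ** y)) *+ 4] of [idem_mul] is already [x ** y]; on V it vanishes,
    which gives [peirce_VV]. *)
Lemma peirce_UU x y : x \in U -> y \in U -> V (x ** y).
Proof.
move=> Ux Uy; have H := idem_mul (NU Ux) (NU Uy).
rewrite /peirceV /=; apply: mulr2n_inj; rewrite /= mul0rn.
have E : ((e ** x) ** (e ** y)) *+ 4 = x ** y.
  by rewrite -[in RHS](inU_double Ux) -[in RHS](inU_double Uy) !mulE; zmod.
by apply: (eq_from_sub (etrans H (esym E))); zmod.
Qed.

Lemma peirce_VV x y : V x -> V y -> x ** y \in U.
Proof.
move=> Vx Vy; apply: inUP; have := idem_mul (NV Vx) (NV Vy).
by rewrite Vx Vy mul0l mul0rn addr0.
Qed.

Lemma peirce_VU u v : u \in U -> V v -> v ** u \in U.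
Proof. exact: (peirce_UV char2 char3 hB he0 he). Qed.

(** Since [e] acts as one half on U and as zero on V, [cubic3] with one, two or three arguments in U
    yields this lemma, [mulL_skew] and [mulUUU]. *)
Lemma mul_U_VV u v w : u \in U -> V v -> V w -> u ** (v ** w) = 0.
Proof.
move=> Uu Vv Vw; rewrite -(inU_double Uu) mulMnl.
have := cubic3 (NU Uu) (NV Vv) (NV Vw).
by rewrite Vv Vw !mul0l !addr0 => ->; rewrite mul0rn.
Qed.

Lemma mulL_skew v x y : V v -> x \in U -> y \in U ->
  (v ** x) ** y = - (x ** (v ** y)).
Proof.
move=> Vv Ux Uy; have := cubic3 (NV Vv) (NU Ux) (NU Uy).
rewrite Vv mul0l add0r => /(congr1 (fun x => x *+ 2)).
rewrite mul0rn mulrnDl -(mulMnl (e ** x)) -(mulMnl (e ** y)).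
rewrite !inU_double // => H.
by apply: (eq_from_sub H); rewrite (mC y v) (mC y (v ** x)); zmod.
Qed.

Lemma mulUUU x y z : x \in U -> y \in U -> z \in U ->
  (x ** y) ** z = - ((y ** z) ** x) - ((z ** x) ** y).
Proof.
move=> Ux Uy Uz; have := cubic3 (NU Ux) (NU Uy) (NU Uz).
move=> /(congr1 (fun x => x *+ 2)).
rewrite mul0rn !mulrnDl -(mulMnl (e ** x)) -(mulMnl (e ** y)).
rewrite -(mulMnl (e ** z)) !inU_double // => H; apply: (eq_from_sub H).
by rewrite (mC x (_ ** _)) (mC y (_ ** _)) (mC z (_ ** _)); zmod.
Qed.

Lemma mulUU_VU v x y z : V v -> x \in U -> y \in U -> z \in U ->
  (x ** y) ** (v ** z) = - ((x ** z) ** (v ** y)) - ((y ** z) ** (v ** x)).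
Proof.
move=> Vv Ux Uy Uz; have H := quartic_N4 (NU Ux) (NU Uz) (NU Uy) (NV Vv).
by apply: (eq_from_sub H); rewrite (mC z v) (mC x v) (mC y v); zmod.
Qed.

(** * Products of points on an orbit of L_v *)

Section LeftMultiplication.

Variable v : A.
Hypothesis Vv : V v.

Local Notation L n x := (iter n (mul v) x).

Lemma iterL_inU n u : u \in U -> L n u \in U.
Proof. by move=> Uu; elim: n => //= n IH; apply: peirce_VU. Qed.

(** By [mulL_skew], each of the [i] factors L moved to the right costs a sign. *)
Lemma iterL_mul u i j : u \in U ->
  L i u ** L j u = (-1) ^+ i *: (u ** L (i + j) u).
Proof.
move=> Uu; elim: i j => [|i IH] j; first by rewrite expr0 scale1r.
rewrite [L i.+1 u]/= mulL_skew ?iterL_inU // -[v ** _]/(L j.+1 u) IH addnS.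
by rewrite exprS mulN1r scaleNr.
Qed.

(** Moving all [n] factors across and commuting shows that the product equals its own opposite. *)
Lemma mul_iterL_odd u n : u \in U -> odd n -> u ** L n u = 0.
Proof.
move=> Uu on; have := iterL_mul n 0 Uu; rewrite addn0 mC -signr_odd on /=.
rewrite expr1 scaleN1r => H; apply: mulr2n_inj; rewrite /= mul0rn.
by apply: (eq_from_sub H); zmod.
Qed.

(* f(n, k) = (u ** L n u) ** L k u vanishes for n odd, while [mulUUU] and
   [mulUU_VU] express it through f(k, n), f(n + k, 0) and through
   f(k - 1, n + 1), f(n + k - 1, 1) respectively; parity settles the rest. *)
Lemma mul_iterL3_base u n k : u \in U -> (u ** L n u) ** L k u = 0.
Proof.
move=> Uu; have UL m : L m u \in U by apply: iterL_inU.
have f_odd m j : odd m -> (u ** L m u) ** L j u = 0.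
  by move=> om; rewrite mul_iterL_odd ?mul0l.
have f_S m j : (u ** L m u) ** L j.+1 u =
    - ((u ** L j u) ** L m.+1 u) - (-1) ^+ m *: ((u ** L (m + j) u) ** L 1 u).
  by rewrite [L j.+1 u]/= mulUU_VU // iterL_mul // linearZl_LR.
have f_cyc m j : (u ** L m u) ** L j u =
    - ((-1) ^+ m *: ((u ** L (m + j) u) ** L 0 u)) - ((u ** L j u) ** L m u).
  by rewrite mulUUU // iterL_mul // linearZl_LR /= (mC u (L j u)).
have f_eo m j : odd j -> (u ** L m u) ** L j u = 0.
  move=> oj; have [om|em] := boolP (odd m); first exact: f_odd.
  rewrite f_cyc f_odd; last by rewrite oddD (negPf em).
  by rewrite f_odd // scaler0 oppr0 addr0.
have f_ee m j : ~~ odd m -> odd j -> (u ** L m u) ** L j.+1 u = 0.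
  move=> em oj; rewrite f_S f_odd // f_odd; last by rewrite oddD (negPf em).
  by rewrite scaler0 oppr0 addr0.
have [on|en] := boolP (odd n); first exact: f_odd.
have [ok|ek] := boolP (odd k); first exact: f_eo.
case: k ek => [|k] ek; last by apply: f_ee => //; apply: negbNE.
(* For [n] even this reads 2 f(n, 0) = - f(0, n). If [n] is 0 it says 3 f(0, 0) = 0; otherwise
   [f_ee] kills the right-hand side. *)
have := f_cyc n 0; rewrite addn0 -signr_odd (negPf en) expr0 scale1r => /= H.
case: n en H => [_ /= H|n /negbNE on].
  by apply: mulr3n_inj; rewrite /= mul0rn; apply: (eq_from_sub H); zmod.
rewrite (f_ee 0) // subr0 => /= H.
by apply: mulr2n_inj; rewrite /= mul0rn; apply: (eq_from_sub H); zmod.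
Qed.

Lemma mul_iterL3 u i j k : u \in U -> (L i u ** L j u) ** L k u = 0.
Proof.
by move=> Uu; rewrite iterL_mul // linearZl_LR /= mul_iterL3_base // scaler0.
Qed.

End LeftMultiplication.

(** * The annihilator of U in U *)

Definition annihilatorU : set A :=
  [set w | w \in U /\ forall y, y \in U -> w ** y = 0].

Lemma annihilatorU_subspace : is_subspace annihilatorU.
Proof.
split; first by split=> [|y _]; rewrite ?rpred0 // mul0l.
move=> k x y [Ux x0] [Uy y0]; split=> [|z Uz]; first by rewrite rpredD ?rpredZ.
by rewrite mulDl linearZl_LR /= x0 // y0 // scaler0 addr0.
Qed.

Lemma annihilatorU_VV x y : V x -> V y -> annihilatorU (x ** y).
Proof.
by move=> Vx Vy; split=> [|z Uz]; [apply: peirce_VV | rewrite mC mul_U_VV].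
Qed.

(** [mulL_skew] moves [v] onto the other factor, which stays in U. *)
Lemma annihilatorU_L v w : V v -> annihilatorU w -> annihilatorU (v ** w).
Proof.
move=> Vv [Uw w0]; split=> [|y Uy]; first exact: peirce_VU.
by rewrite mulL_skew // w0 ?oppr0 //; apply: peirce_VU.
Qed.

(** In [mulUUU] the other two terms contain [y ** w] or [w ** x]. *)
Lemma annihilatorU_UU x y w : x \in U -> y \in U -> annihilatorU w ->
  (x ** y) ** w = 0.
Proof.
move=> Ux Uy [Uw w0]; rewrite mulUUU // (mC y w) !w0 //.
by rewrite !mul0l oppr0 addr0.
Qed.

(** * From locally algebraic operators to algebraic elements *)

Lemma idem_lspanU s w : w \in U -> w \in s -> lspan s (e ** w).
Proof.
move=> Uw ws; have -> : e ** w = 2%:R^-1 *: w.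
  by rewrite -[in RHS](inU_double Uw) -scaler_nat scalerA mulVf ?scale1r //.
exact/(subspaceZ _ (lspan_subspace s))/lspan_mem.
Qed.

Lemma lspan0 (s : seq A) : lspan s 0.
Proof. by case: (lspan_subspace s). Qed.

(* With a = k e + u + v, D spanning the orbit of u under L_v and R = D D, the
   subalgebra is spanned by e, v, D, R and the orbits E under L_v of the
   products of two elements of Q = {v} + R; these orbits annihilate U. *)
Lemma algebraic_of_locally_algebraic :
  (forall v u, V v -> u \in U -> algebraic_at (mul v) u) ->
  forall a, algebraic_elt mul a.
Proof.
move=> alg a.
have [v [u [k [Vv Uu aE]]]] : exists v u k,
    [/\ V v, u \in U & a = k *: e + (u + v)].
  have N0 : N (a - omega a *: e).
    by rewrite /= linearB linearZ /= (weight_idem hB he0 he) mulr1 subrr.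
  have [u [v [Uu Vv E]]] := peirce_decomp N0.
  by exists v, u, (omega a); split=> //; rewrite -E addrC subrK.
have krylov w : w \in U -> exists s : seq A,
    (forall x, x \in s -> exists n, x = iter n (mul v) w) /\
    forall n, lspan s (iter n (mul v) w).
  move=> Uw; have [d dP] := krylov_span (alg v w Vv Uw).
  exists (mkseq (fun i => iter i (mul v) w) d); split=> // x /mapP[n _ ->].
  by exists n.
have krylovs (ws : seq A) : {subset ws <= U} -> exists s : seq A,
    (forall x, x \in s -> exists n w, w \in ws /\ x = iter n (mul v) w) /\
    forall n w, w \in ws -> lspan s (iter n (mul v) w).
  elim: ws => [_|w ws IH wsU]; first by exists [::].
  have [|s [s1 s2]] := IH.
    by move=> x xs; apply: wsU; rewrite inE xs orbT.
  have [|t [t1 t2]] := krylov w; first by apply: wsU; rewrite mem_head.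
  exists (t ++ s); split=> [x|n x].
    rewrite mem_cat => /orP[/t1[n ->]|/s1[n [y [ys ->]]]].
      by exists n, w; rewrite mem_head.
    by exists n, y; rewrite inE ys orbT.
  rewrite inE => /predU1P[->|xs].
    by apply: sub_lspan (t2 n) => y; rewrite mem_cat => ->.
  by apply: sub_lspan (s2 n x xs) => y; rewrite mem_cat orbC => ->.
have [D [D1 D2]] := krylov u Uu.
pose R := [seq x ** y | x <- D, y <- D].
have DU x : x \in D -> x \in U by move=> /D1[n ->]; apply: iterL_inU.
have RP x : x \in R -> exists i j, x = iter i (mul v) u ** iter j (mul v) u.
  by move=> /allpairsP[[y z] /= [/D1[i ->] /D1[j ->] ->]]; exists i, j.
have RV x : x \in R -> V x.
  by move=> /RP[i [j ->]]; apply: peirce_UU; apply: iterL_inU.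
(* [Q] gathers [v] and [R], all in V, into one block of the multiplication table. *)
have [Q [vQ RQ QP]] : exists Q : seq A, [/\ v \in Q, {subset R <= Q} &
    forall x, x \in Q -> x = v \/ x \in R].
  exists (v :: R); split=> [|x xR|x]; rewrite inE ?eqxx ?xR ?orbT //.
  by case/predU1P; [left | right].
have QV x : x \in Q -> V x by move=> /QP[->|/RV].
pose W := [seq x ** y | x <- Q, y <- Q].
have WA w : w \in W -> annihilatorU w.
  by move=> /allpairsP[[y z] /= [/QV Vy /QV Vz ->]]; apply: annihilatorU_VV.
have [|E [E1 E2]] := krylovs W; first by move=> w /WA[].
have EA x : x \in E -> annihilatorU x.
  move=> /E1[n [w [/WA ww ->]]]; elim: n => //= n; exact: annihilatorU_L.
pose s := e :: Q ++ D ++ E.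
have sQ x : x \in Q -> x \in s by move=> xQ; rewrite /s in_cons mem_cat xQ orbT.
have sD x : x \in D -> x \in s.
  by move=> xD; rewrite /s in_cons !mem_cat xD !orbT.
have sE x : x \in E -> x \in s.
  by move=> xE; rewrite /s in_cons !mem_cat xE !orbT.
have EU x : x \in E -> x \in U by move=> /EA[].
have es x : x \in s -> lspan s (e ** x).
  rewrite in_cons !mem_cat => /predU1P[->|].
    by rewrite [e ** e]he; apply: lspan_mem; rewrite mem_head.
  case/or3P => [/QV ->|xD|xE]; first exact: lspan0.
    by apply: idem_lspanU; [apply: DU | apply: sD].
  by apply: idem_lspanU; [apply: EU | apply: sE].
(* Such a product belongs to [W] and is point 0 of its own orbit. *)
have QQ : {in Q & Q, forall x y, lspan s (x ** y)}.
  move=> x y xQ yQ; apply: (sub_lspan sE); apply: (E2 0).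
  by apply/allpairsP; exists (x, y).
(* [v] shifts the orbit of [u] by one, and [R] kills it by [mul_iterL3]. *)
have QD : {in Q & D, forall x y, lspan s (x ** y)}.
  move=> x y /QP[->|xR] yD.
    by have [n ->] := D1 y yD; apply: (sub_lspan sD); apply: (D2 n.+1).
  have [i [j ->]] := RP x xR; have [n ->] := D1 y yD.
  by rewrite mul_iterL3 //; apply: lspan0.
(* Again [v] shifts the orbits, while [R] kills the annihilator by [annihilatorU_UU]. *)
have QE : {in Q & E, forall x y, lspan s (x ** y)}.
  move=> x y /QP[->|xR] yE.
    have [n [w [wW ->]]] := E1 y yE; apply: (sub_lspan sE).
    exact: (E2 n.+1 w wW).
  have [i [j ->]] := RP x xR.
  by rewrite annihilatorU_UU ?iterL_inU //; [apply: lspan0 | apply: EA].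
have DD : {in D & D, forall x y, lspan s (x ** y)}.
  move=> x y xD yD; apply/lspan_mem/sQ/RQ.
  by apply/allpairsP; exists (x, y).
have EDE x y : x \in E -> y \in U -> lspan s (x ** y).
  by move=> /EA[_ x0] /x0 ->; apply: lspan0.
have sM : {in s &, forall x y, lspan s (x ** y)}.
  move=> x y xs ys; move: (xs) (ys); rewrite /s !in_cons !mem_cat.
  move=> /predU1P[-> _|xs']; first exact: es.
  move=> /predU1P[->|ys']; first by rewrite mC; apply: es.
  case/or3P: xs' ys' => [xQ|xD|xE] /or3P[yQ|yD|yE].
  - exact: QQ.
  - exact: QD.
  - exact: QE.
  - by rewrite mC; apply: QD.
  - exact: DD.
  - by rewrite mC; apply: EDE => //; apply: DU.
  - by rewrite mC; apply: QE.
  - by apply: EDE => //; apply: DU.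
  - by apply: EDE => //; apply: EU.
apply: (algebraic_elt_span sM); rewrite aE; have hs := lspan_subspace s.
apply: subspaceD => //.
  by apply: subspaceZ => //; apply: lspan_mem; rewrite mem_head.
apply: subspaceD => //; first by apply: (sub_lspan sD); apply: (D2 0%N).
exact/lspan_mem/sQ.
Qed.

(** * From an algebraic kernel to locally algebraic operators *)

Lemma algebraic_at_sqr a : algebraic_elt mul a -> algebraic_at (mul a) (a ** a).
Proof.
move=> fd; have [_ GM] := gen_subalgebraP mul a.
have Ga := @gen_subalgebra_mem _ _ mul a.
(* The iterates never leave the subalgebra generated by [a]. *)
apply: (fd_dependent (x := fun n => iter n (mul a) (a ** a)) fd) => n.
by elim: n => [|n IH] /=; apply: GM.
Qed.

Lemma algebraic_at_annihilatorU v w :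
  (forall a, N a -> algebraic_elt mul a) -> V v -> annihilatorU w ->
  algebraic_at (mul v) w.
Proof.
move=> algN Vv Aw; have [Uw w0] := Aw.
have Na : N (v + w) by have [] := ker_addsub (NV Vv) (NU Uw).
have aE : (v + w) ** (v + w) = v ** v + (v ** w) *+ 2.
  by rewrite !mulE (w0 w) // (mC w v) mulr2n addr0 addrA.
have Aa : annihilatorU ((v + w) ** (v + w)).
  rewrite aE mulr2n; have hA := annihilatorU_subspace.
  do 2?apply: subspaceD => //;
    [exact: annihilatorU_VV | exact: annihilatorU_L..].
(* The iterates stay in the annihilator of U, which [w] kills, so [v + w] acts on them as [v]. *)
have iterE n : annihilatorU (iter n (mul v) ((v + w) ** (v + w))) /\
    iter n (mul (v + w)) ((v + w) ** (v + w)) =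
    iter n (mul v) ((v + w) ** (v + w)).
  elim: n => //= n [IA ->]; split; first exact: annihilatorU_L.
  by rewrite mulDl (w0 _ (proj1 IA)) addr0.
have sub := algebraic_at_subspace (mul v).
have h1 : algebraic_at (mul v) ((v + w) ** (v + w)).
  have [P P0 Pa] := algebraic_at_sqr (algN _ Na); exists P => //.
  by rewrite -[RHS]Pa; apply: eq_bigr => i _; rewrite (iterE i).2.
have h2 : algebraic_at (mul v) (v ** v) := algebraic_at_sqr (algN _ (NV Vv)).
apply: algebraic_at_image; change (algebraic_at (mul v) (v ** w)).
have n2 : 2%:R != 0 :> K by move: char2; rewrite !inE.
have -> : v ** w = 2%:R^-1 *: ((-1) *: (v ** v) + (v + w) ** (v + w)).
  by rewrite aE scaleN1r addKr -scaler_nat scalerA mulVf // scale1r.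
by apply: (subspaceZ _ sub); case: sub => _; apply.
Qed.

(* With a = v + u, the term u ** iter n (mul v) u lies in V and is killed by u,
   so modulo V and the annihilator of U the powers of a follow the orbit of u
   under mul v. *)
Lemma iter_mulD v u n : V v -> u \in U -> exists w k, annihilatorU w /\
  iter n (mul (v + u)) ((v + u) ** (v + u)) =
  (iter n.+1 (mul v) u) *+ 2 + w + (u ** iter n (mul v) u) *+ k.
Proof.
move=> Vv Uu; elim: n => [|n [w [k [Aw IH]]]].
  exists (v ** v), 1%N; split; first exact: annihilatorU_VV.
  by rewrite /= !mulE (mC u v); zmod.
exists (v ** w + (v ** (u ** iter n (mul v) u)) *+ k), 2%N; split.
  have hA := annihilatorU_subspace; apply: subspaceD => //.
    exact: annihilatorU_L.
  rewrite -scaler_nat; apply: subspaceZ => //; apply: annihilatorU_VV => //.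
  by apply: peirce_UU => //; apply: iterL_inU.
rewrite !iterS IH !mulE.
have -> : u ** w = 0 by rewrite mC (proj2 Aw).
have -> : u ** (u ** iter n (mul v) u) = 0.
  by rewrite mC; apply: (mul_iterL3_base Vv n 0 Uu).
(* [k] is not a numeral, so its multiple is turned into an atom before [zmod]. *)
by rewrite mul0rn /=; move: (_ *+ k) => r; zmod.
Qed.

Lemma algebraic_at_U v u : (forall a, N a -> algebraic_elt mul a) ->
  V v -> u \in U -> algebraic_at (mul v) u.
Proof.
move=> algN Vv Uu; have UL n : iter n (mul v) u \in U by apply: iterL_inU.
have Na : N (v + u) by have [] := ker_addsub (NV Vv) (NU Uu).
have [P P0 Pa] := algebraic_at_sqr (algN _ Na).
pose B := [set x | exists w q, [/\ annihilatorU w, V q & x = w + q]].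
have hA := annihilatorU_subspace.
have hB' : is_subspace B.
  split; first by exists 0, 0; split; rewrite ?addr0 //= ?mul0r //; case: hA.
  move=> k _ _ [w [q [Aw Vq ->]]] [w' [q' [Aw' Vq' ->]]].
  exists (k *: w + w'), (k *: q + q'); split; first by case: hA => _; apply.
    by rewrite /peirceV /= mulDr linearZr_LR /= Vq Vq' scaler0 addr0.
  by rewrite scalerDr; zmod.
have canc (x y z : A) : x + y + z - x = y + z by zmod.
(* By [iter_mulD], the i-th iterate of the square is 2 L^i (L u) modulo [B]; the coefficients of [P]
   combine these congruences. *)
have [w [q [Aw Vq]]] : B (poly_apply P (mul (v + u)) ((v + u) ** (v + u)) -
    poly_apply P (mul v) (v ** u) *+ 2).
  rewrite /poly_apply -sumrMnl -sumrB; apply: subspace_sum => // i.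
  have [w [k [Aw ->]]] := iter_mulD i Vv Uu.
  rewrite -iterSr scalerMnr -scalerBr; apply: subspaceZ => //.
  exists w, ((u ** iter i (mul v) u) *+ k); split=> //.
  by rewrite /peirceV /= mulMnr peirce_UU ?mul0rn.
rewrite Pa sub0r => E; set p := poly_apply P _ _ in E.
have Up : p \in U.
  rewrite /p /poly_apply; apply: rpred_sum => i _; apply: rpredZ.
  by rewrite -iterSr.
(* [w + q] is -2 [p] with [p] and [w] in U, so [q] lies in both U and V. *)
have q0 : q = 0.
  apply: peirceUV0 => //; have -> : q = - (p *+ 2) - w by rewrite E; zmod.
  by rewrite rpredB ?rpredN ?rpredMn //; case: Aw.
apply/algebraic_at_image/(algebraic_at_poly P0); rewrite -/p.
have n2 : 2%:R != 0 :> K by move: char2; rewrite !inE.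
(* Thus [p] lies in the annihilator of U, where algebraicity is known. *)
have -> : p = (- 2%:R^-1) *: w.
  rewrite -[w]addr0 -q0 -E scaleNr scalerN opprK -scaler_nat scalerA.
  by rewrite mulVf // scale1r.
have sub := algebraic_at_subspace (mul v).
by apply: (subspaceZ _ sub); apply: algebraic_at_annihilatorU.
Qed.

End BernsteinIdentities.

(** * The cycle of implications *)

Theorem theorem2p14 (K : fieldType) (A : lmodType K)
    (mul : {bilinear A -> A -> A}) (omega : {scalar A}) (e : A)
    (Kinf : infinite_set [set: K])
    (char2 : 2%N \notin [pchar K]) (char3 : 3%N \notin [pchar K])
    (hB : is_bernstein mul omega)
    (he0 : e != 0) (he : is_idempotent mul e) :
  [<-> algebraic_set mul [set: A];
       algebraic_set mul [set x | omega x = 0];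
       forall (v : A) (hv : peirceV mul e v),
         locally_algebraic (peirceL char2 char3 hB he0 he hv)].
Proof.
(* The inclusion of U in [A] intertwines [peirceL] with [mul v], which transfers annihilating
   polynomials both ways. *)
have poly_val v (hv : peirceV mul e v) P (a : peirceU mul e) :
    \val (poly_apply P (peirceL char2 char3 hB he0 he hv) a) =
    poly_apply P (mul v) (\val a).
  rewrite /poly_apply raddf_sum; apply: eq_bigr => i _.
  apply: (etrans (GRing.valZ _ _ : \val (_ *: (_ : peirceU mul e)) = _)).
  by congr (_ *: _); elim: (i : nat) => //= n <-.
tfae.
- by move=> algA a _; apply: algA.
- move=> algN v hv a.
  have [|P P0 Pa] := algebraic_at_U char2 char3 hB he0 he algN hv (u := \val a).
    exact: valP.
  by exists P => //; apply: val_inj; rewrite poly_val Pa.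
- move=> locL a _.
  apply: (algebraic_of_locally_algebraic char2 char3 hB he0 he) => v u hv Uu.
  have [P P0 Pa] := locL v hv (PeirceU Uu); exists P => //.
  by rewrite -[u]/(\val (PeirceU Uu)) -poly_val Pa.
Qed.
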